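(* Let $\Lambda$ be a row-finite, locally-convex $k$-graph and $R$ a commutative ring with $1$. If $J$ is a basic ideal of $KP_R(\Lambda)$, then $I(H(J))$ is the largest basic, graded ideal of $KP_R(\Lambda)$ contained in $J$.
   Context: A $k$-graph $(\Lambda,d)$ is a countable category $\Lambda$ with a functor $d:\Lambda\to\mathbb{N}^k$ satisfying unique factorization: whenever $d(\lambda)=m+n$ there are unique $\mu,\nu$ with $d(\mu)=m$, $d(\nu)=n$, $\lambda=\mu\nu$. Paths are morphisms, vertices $\Lambda^0$ are the degree-$0$ paths, $r,s$ are range and source, $\mathbb{N}^k$ is ordered coordinatewise, $e_i$ are standard generators, $v\Lambda^m=\{\lambda: r(\lambda)=v,d(\lambda)=m\}$. Row-finite: each $v\Lambda^m$ finite. $\Lambda^{\le n}=\{\lambda: d(\lambda)\le n,\ d(\lambda)_i<n_i\Rightarrow s(\lambda)\Lambda^{e_i}=\emptyset\}$. Locally-convex: for $i\ne j$, $\lambda\in v\Lambda^{e_i}$, $\mu\in v\Lambda^{e_j}$, both $s(\lambda)\Lambda^{e_j}$ and $s(\mu)\Lambda^{e_i}$ are nonempty. $KP_R(\Lambda)$ is the universal $R$-algebra generated by a Kumjian–Pask family $(p,s)$: elements $p_v$ ($v\in\Lambda^0$), $s_\lambda,s_{\lambda^*}$ (non-vertex $\lambda$) with (KP1) $p_v$ mutually orthogonal idempotents; (KP2) $s_\lambda s_\mu=s_{\lambda\mu}$, $s_{\mu^*}s_{\lambda^*}=s_{(\lambda\mu)^*}$, $p_{r(\lambda)}s_\lambda=s_\lambda=s_\lambda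 p_{s(\lambda)}$, $p_{s(\lambda)}s_{\lambda^*}=s_{\lambda^*}=s_{\lambda^*}p_{r(\lambda)}$; (KP3) $s_{\lambda^*}s_\mu=\delta_{\lambda,\mu}p_{s(\lambda)}$ for $\lambda,\mu\in\Lambda^{\le n}$, $n\neq0$; (KP4) $p_v=\sum_{\lambda\in v\Lambda^{\le n}}s_\lambda s_{\lambda^*}$ for $n\ne 0$. It is $\mathbb{Z}^k$-graded by $KP_R(\Lambda)_n=\mathrm{span}\{s_\alpha s_{\beta^*}: d(\alpha)-d(\beta)=n\}$; an ideal is graded if it contains the homogeneous components of each of its elements. An ideal $I$ is basic if $rp_v\in I$, $r\in R\setminus\{0\}$ imply $p_v\in I$. $H(I)=\{v\in\Lambda^0: p_v\in I\}$, and for $H\subseteq\Lambda^0$, $I(H)$ is the ideal generated by $\{p_v:v\in H\}$. *)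

(* Defs.v *)
From HB Require Import structures.
From mathcomp Require Import all_boot all_order all_algebra.
Set Implicit Arguments.
Unset Strict Implicit.
Unset Printing Implicit Defensive.
Import GRing.Theory.
Local Open Scope ring_scope.

Definition ek (k : nat) (i : 'I_k) : 'I_k -> nat := fun j => nat_of_bool (j == i).

(* A k-graph: a countable category (objects Obj, morphisms = paths Mor, with
   range rg = codomain, source sg = domain, identities idm, composition comp,
   where comp l m is the composite "l m" and is only meaningful when
   sg l = rg m), with a degree functor deg : Mor -> N^k satisfying the
   unique factorization property. *)
Record kgraph (k : nat) := KGraph {
  Obj : countType;
  Mor : countType;
  rg : Mor -> Obj;
  sg : Mor -> Obj;
  idm : Obj -> Mor;
  comp : Mor -> Mor -> Mor;
  deg : Mor -> 'I_k -> nat;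
  rg_idm : forall v, rg (idm v) = v;
  sg_idm : forall v, sg (idm v) = v;
  comp_idl : forall l, comp (idm (rg l)) l = l;
  comp_idr : forall l, comp l (idm (sg l)) = l;
  rg_comp : forall l m, sg l = rg m -> rg (comp l m) = rg l;
  sg_comp : forall l m, sg l = rg m -> sg (comp l m) = sg m;
  compA : forall l m n, sg l = rg m -> sg m = rg n ->
            comp l (comp m n) = comp (comp l m) n;
  deg_idm : forall v i, deg (idm v) i = 0%N;
  deg_comp : forall l m, sg l = rg m ->
            forall i, deg (comp l m) i = (deg l i + deg m i)%N;
  unique_fact : forall l (m n : 'I_k -> nat),
     (forall i, deg l i = (m i + n i)%N) ->
     exists mu, exists nu,
       (sg mu = rg nu /\ (forall i, deg mu i = m i) /\
        (forall i, deg nu i = n i) /\ l = comp mu nu) /\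
       (forall mu' nu', sg mu' = rg nu' -> (forall i, deg mu' i = m i) ->
          (forall i, deg nu' i = n i) -> l = comp mu' nu' ->
          mu' = mu /\ nu' = nu)
}.

Section KGraphDefs.
Variables (k : nat) (G : kgraph k).

Definition row_finite : Prop :=
  forall (v : Obj G) (m : 'I_k -> nat), exists s : seq (Mor G),
    forall l, rg l = v -> (forall i, deg l i = m i) -> l \in s.

Definition in_Lle (n : 'I_k -> nat) (l : Mor G) : Prop :=
  (forall i, (deg l i <= n i)%N) /\
  (forall i, (deg l i < n i)%N ->
     forall mu : Mor G, rg mu = sg l -> ~ (forall j, deg mu j = ek i j)).

Definition locally_convex : Prop :=
  forall i j : 'I_k, i != j -> forall l mu : Mor G, rg l = rg mu ->
    (forall t, deg l t = ek i t) -> (forall t, deg mu t = ek j t) ->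
    (exists a, rg a = sg l /\ forall t, deg a t = ek j t) /\
    (exists b, rg b = sg mu /\ forall t, deg b t = ek i t).

Definition nonzero_deg (n : 'I_k -> nat) : Prop := exists i, n i != 0%N.

End KGraphDefs.

Record nalg (R : pzRingType) := NAlg {
  nalg_car :> lmodType R;
  nmul : nalg_car -> nalg_car -> nalg_car;
  nmulA : forall x y z, nmul x (nmul y z) = nmul (nmul x y) z;
  nmulDl : forall x y z, nmul (x + y) z = nmul x z + nmul y z;
  nmulDr : forall x y z, nmul x (y + z) = nmul x y + nmul x z;
  nmulZl : forall r x y, nmul (r *: x) y = r *: nmul x y;
  nmulZr : forall r x y, nmul x (r *: y) = r *: nmul x y
}.
Arguments nmul {R n} _ _.

Section KPDefs.
Variables (k : nat) (G : kgraph k) (R : pzRingType).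

Definition nalg_hom (A B : nalg R) (f : A -> B) : Prop :=
  (forall x y, f (x + y) = f x + f y) /\
  (forall r x, f (r *: x) = r *: f x) /\
  (forall x y, f (nmul x y) = nmul (f x) (f y)).

(* Kumjian-Pask family (p, s) in A; sp l = s_l, sps l = s_{l^*}, with the
   convention s_v = s_{v^*} = p_v for vertices (identity paths). *)
Definition KP_family (A : nalg R) (p : Obj G -> A) (sp sps : Mor G -> A) : Prop :=
  (forall v, sp (idm v) = p v /\ sps (idm v) = p v) /\
  (forall v, nmul (p v) (p v) = p v) /\
  (forall v w, v <> w -> nmul (p v) (p w) = 0) /\
  (forall l m, sg l = rg m ->
     sp (comp l m) = nmul (sp l) (sp m) /\ sps (comp l m) = nmul (sps m) (sps l)) /\
  (forall l, nmul (p (rg l)) (sp l) = sp l /\ nmul (sp l) (p (sg l)) = sp l /\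
             nmul (p (sg l)) (sps l) = sps l /\ nmul (sps l) (p (rg l)) = sps l) /\
  (forall n, nonzero_deg n -> forall l m, in_Lle n l -> in_Lle n m ->
     nmul (sps l) (sp m) = if l == m then p (sg l) else 0) /\
  (forall n, nonzero_deg n -> forall v (ls : seq (Mor G)), uniq ls ->
     (forall l, l \in ls <-> (rg l = v /\ in_Lle n l)) ->
     p v = \sum_(l <- ls) nmul (sp l) (sps l)).

Definition is_KP_algebra (A : nalg R) (p : Obj G -> A) (sp sps : Mor G -> A) : Prop :=
  KP_family p sp sps /\
  forall (B : nalg R) (q : Obj G -> B) (t ts : Mor G -> B), KP_family q t ts ->
    exists f : A -> B,
      (nalg_hom f /\ (forall v, f (p v) = q v) /\
       (forall l, f (sp l) = t l /\ f (sps l) = ts l)) /\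
      (forall g : A -> B, nalg_hom g -> (forall v, g (p v) = q v) ->
         (forall l, g (sp l) = t l /\ g (sps l) = ts l) -> forall x, g x = f x).

Definition ideal (A : nalg R) (I : A -> Prop) : Prop :=
  I 0 /\ (forall x y, I x -> I y -> I (x - y)) /\
  (forall r x, I x -> I (r *: x)) /\
  (forall a x, I x -> I (nmul a x) /\ I (nmul x a)).

Definition basic_ideal (A : nalg R) (p : Obj G -> A) (I : A -> Prop) : Prop :=
  ideal I /\ forall v (r : R), r != 0 -> I (r *: p v) -> I (p v).

Definition homog (A : nalg R) (sp sps : Mor G -> A) (n : {ffun 'I_k -> int}) (x : A) : Prop :=
  exists l : seq (R * Mor G * Mor G),
    (forall c, c \in l -> forall i, (deg c.1.2 i)%:Z - (deg c.2 i)%:Z = n i) /\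
    x = \sum_(c <- l) c.1.1 *: nmul (sp c.1.2) (sps c.2).

Definition graded_ideal (A : nalg R) (sp sps : Mor G -> A) (I : A -> Prop) : Prop :=
  ideal I /\
  forall x, I x -> forall l : seq ({ffun 'I_k -> int} * A),
    uniq (map fst l) -> (forall c, c \in l -> homog sp sps c.1 c.2) ->
    x = \sum_(c <- l) c.2 -> forall c, c \in l -> I c.2.

Definition H_of (A : nalg R) (p : Obj G -> A) (J : A -> Prop) : Obj G -> Prop :=
  fun v => J (p v).

Definition I_of (A : nalg R) (p : Obj G -> A) (H : Obj G -> Prop) : A -> Prop :=
  fun x => forall I : A -> Prop, ideal I -> (forall v, H v -> I (p v)) -> I x.

End KPDefs.

(* Main.v *)
(* Let I' be a basic graded ideal and x in I' homogeneous of degree d.  By KP4, x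
   is a combination of terms s_a s_b^* with every b in Lambda^{<=n} for one n.
   For each such b0, KP3 turns x s_b0 into a combination of the s_a with (a, b0)
   in the sum; these all have degree d + d(b0), so s_a0^* x s_b0 = r p_{s(a0)}
   where r is the coefficient of s_a0 s_b0^*.  As I' is basic, r = 0 or
   p_{s(a0)} is in I', so each term lies in I(H(I')).  Hence I' = I(H(I')), and
   I' inside J gives I' inside I(H(J)).  That the Z^k-grading is direct, and that
   the s_a s_b^* span, both follow from the universal property, applied to an
   algebra of formal sums of homogeneous elements. *)
From HB Require Import structures.
From mathcomp Require Import all_boot all_order all_algebra.
From mathcomp Require Import boolp functions.
Require Import Defs.
Set Implicit Arguments.
Unset Strict Implicit.
Unset Printing Implicit Defensive.
Import GRing.Theory.
Local Open Scope ring_scope.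

(** * Regrouping finite sums *)

Lemma big_group (T K : eqType) (V : nmodType) (key : T -> K) (l : seq T)
    (F : T -> V) :
  \sum_(c <- l) F c
  = \sum_(x <- undup (map key l)) \sum_(c <- l | key c == x) F c.
Proof.
under [RHS]eq_bigr do rewrite big_mkcond.
rewrite exchange_big; apply: eq_big_seq => c cl.
rewrite (bigD1_seq (key c)) /= ?undup_uniq ?mem_undup ?map_f // eqxx.
by rewrite big1 ?addr0 // => x; rewrite eq_sym => /negPf->.
Qed.

Lemma uniq_map_inj (T K : eqType) (f : T -> K) (s : seq T) :
  uniq (map f s) -> {in s &, injective f}.
Proof.
elim: s => //= z s IHs /andP[fz us] x y.
rewrite !inE => /predU1P[->|xs] /predU1P[->|ys] //; last exact: IHs.
  by move=> fzy; case/negP: fz; rewrite fzy map_f.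
by move=> fxz; case/negP: fz; rewrite -fxz map_f.
Qed.

(** * Ideals and sums in non-unital algebras *)

Section NalgTheory.
Variables (R : pzRingType) (A : nalg R).
Implicit Types (x y : A) (I : A -> Prop).

Lemma nmul0l x : nmul 0 x = 0.
Proof. by rewrite -[0 in LHS](scale0r (0 : A)) nmulZl scale0r. Qed.

Lemma nmul0r x : nmul x 0 = 0.
Proof. by rewrite -[0 in LHS](scale0r (0 : A)) nmulZr scale0r. Qed.

Lemma nmul_suml (T : Type) (l : seq T) (P : pred T) (F : T -> A) x :
  nmul (\sum_(c <- l | P c) F c) x = \sum_(c <- l | P c) nmul (F c) x.
Proof.
exact: (big_morph (fun y => nmul y x) (fun y z => nmulDl y z x) (nmul0l x)).
Qed.

Lemma nmul_sumr (T : Type) (l : seq T) (P : pred T) (F : T -> A) x :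
  nmul x (\sum_(c <- l | P c) F c) = \sum_(c <- l | P c) nmul x (F c).
Proof. exact: (big_morph (nmul x) (nmulDr x) (nmul0r x)). Qed.

Lemma idealD I x y : ideal I -> I x -> I y -> I (x + y).
Proof.
case=> I0 [IB _] Ix Iy; rewrite -[y]opprK -[- y]sub0r.
by apply: (IB x (0 - y)) => //; apply: IB.
Qed.

Lemma ideal_sum (T : eqType) I (l : seq T) (P : pred T) (F : T -> A) :
  ideal I -> (forall c, c \in l -> P c -> I (F c)) -> I (\sum_(c <- l | P c) F c).
Proof.
move=> idI IF; rewrite big_seq_cond; elim/big_rec: _ => [|c x /andP[cl Pc] Ix].
  by case: idI.
by apply: idealD => //; apply: IF.
Qed.

End NalgTheory.

(** * Paths of bounded degree *)

Section Paths.
Variables (k : nat) (G : kgraph k).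
Implicit Types (l m : Mor G) (n : 'I_k -> nat).

(** Both [comp (idm (rg l)) l] and [comp l (idm (sg l))] factor [l] in degrees 0 + 0, so unique
    factorization identifies their left factors. *)
Lemma deg0_idm l : (forall i, deg l i = 0%N) -> l = idm (rg l).
Proof.
move=> l0.
have [|mu [nu [_ uniq_munu]]] :=
  @unique_fact _ _ l (fun=> 0%N) (fun=> 0%N); first by move=> i; rewrite l0.
have -> : idm (rg l) = mu.
  by apply: (proj1 (uniq_munu _ l _ _ _ _)); rewrite ?sg_idm ?comp_idl // => i;
    rewrite deg_idm.
by apply: (proj1 (uniq_munu _ (idm (sg l)) _ _ _ _)); rewrite ?rg_idm ?comp_idr //
  => i; rewrite deg_idm.
Qed.

Lemma in_Lle_deg n l : (forall i, deg l i = n i) -> in_Lle n l.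
Proof. by move=> ln; split=> i; rewrite ln // ltnn. Qed.

Lemma in_Lle_comp n b l : sg b = rg l -> (forall i, (deg b i <= n i)%N) ->
  in_Lle (fun i => (n i - deg b i)%N) l -> in_Lle n (comp b l).
Proof.
move=> bl bn [ln lmax]; split=> i; rewrite deg_comp // -?leq_subRL //.
rewrite -ltn_subRL => li mu; rewrite sg_comp //; exact: lmax.
Qed.

Lemma Lle_finite : row_finite G -> forall v n, exists ls : seq (Mor G),
  uniq ls /\ forall l, l \in ls <-> rg l = v /\ in_Lle n l.
Proof.
move=> rfG v n.
pose N := \max_i n i.
(* Row-finiteness treats one degree at a time; the degrees below [n] are among the finitely many
   functions into ['I_N.+1]. *)
have [s sP] : exists s : seq (Mor G), forall f : {ffun 'I_k -> 'I_N.+1},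
    forall l, rg l = v -> (forall i, deg l i = f i) -> l \in s.
  suff [s sP] : exists s : seq (Mor G),
      forall f, f \in enum {ffun 'I_k -> 'I_N.+1} ->
      forall l, rg l = v -> (forall i, deg l i = f i) -> l \in s.
    by exists s => f; apply: sP; rewrite mem_enum.
  elim: (enum _) => [|f e [s sP]]; first by exists [::].
  have [t tP] := rfG v (fun i => f i); exists (t ++ s) => g.
  rewrite inE => /predU1P[->|ge] l lv lg; rewrite mem_cat; apply/orP.
    by left; apply: tP.
  by right; apply: (sP g).
exists (undup [seq l <- s | `[< rg l = v /\ in_Lle n l >]]).
split=> [|l]; first exact: undup_uniq.
rewrite mem_undup mem_filter; split=> [/andP[/asboolP]//|lvn].
apply/andP; split; first exact/asboolP.
case: lvn => lv [ln _]; apply: (sP [ffun i => inord (deg l i)]) => // i.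
rewrite ffunE inordK // ltnS (leq_trans (ln i)) //; exact: leq_bigmax.
Qed.

End Paths.

(** * Consequences of the Kumjian-Pask relations *)

Section KumjianPask.
Variables (k : nat) (G : kgraph k) (R : pzRingType) (A : nalg R).
Variables (p : Obj G -> A) (sp sps : Mor G -> A).
Hypothesis rfG : row_finite G.
Hypothesis KP : KP_family p sp sps.
Local Notation grade := {ffun 'I_k -> int}.
Local Notation "x ** y" := (nmul x y) (at level 40, left associativity).

Lemma sp_idm v : sp (idm v) = p v. Proof. by case: KP => /(_ v)[]. Qed.
Lemma sps_idm v : sps (idm v) = p v. Proof. by case: KP => /(_ v)[]. Qed.

Lemma pM v w : p v ** p w = if v == w then p v else 0.
Proof.
by case: KP => _ [pp [p0 _]]; case: eqVneq => [->//|/eqP]; apply: p0.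
Qed.

Lemma sp_comp l m : sg l = rg m -> sp (comp l m) = sp l ** sp m.
Proof. by move=> lm; case: KP => _ [_ [_ [/(_ _ _ lm)[]]]]. Qed.

Lemma sps_comp l m : sg l = rg m -> sps (comp l m) = sps m ** sps l.
Proof. by move=> lm; case: KP => _ [_ [_ [/(_ _ _ lm)[]]]]. Qed.

Lemma p_sp l : p (rg l) ** sp l = sp l.
Proof. by case: KP => _ [_ [_ [_ [/(_ l)[]]]]]. Qed.
Lemma sp_p l : sp l ** p (sg l) = sp l.
Proof. by case: KP => _ [_ [_ [_ [/(_ l)[_ []]]]]]. Qed.
Lemma p_sps l : p (sg l) ** sps l = sps l.
Proof. by case: KP => _ [_ [_ [_ [/(_ l)[_ [_ []]]]]]]. Qed.
Lemma sps_p l : sps l ** p (rg l) = sps l.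
Proof. by case: KP => _ [_ [_ [_ [/(_ l)[_ [_ []]]]]]]. Qed.

Lemma nonzero_degP (n : 'I_k -> nat) : nonzero_deg n \/ forall i, n i = 0%N.
Proof.
case: (pickP (fun i => n i != 0%N)) => [i ni|n0]; first by left; exists i.
by right=> i; apply/eqP/negbFE/n0.
Qed.

(** This extends KP3 to [n = 0]: both paths are then vertices, and KP1 gives the formula. *)
Lemma sps_sp n l m : in_Lle n l -> in_Lle n m ->
  sps l ** sp m = if l == m then p (sg l) else 0.
Proof.
move=> ln mn; case: (nonzero_degP n) => [n0|n0].
  by case: KP => _ [_ [_ [_ [_ [/(_ n n0 l m ln mn)]]]]].
have idE (x : Mor G) : in_Lle n x -> x = idm (rg x).
  by case=> xn _; apply: deg0_idm => i; apply/eqP; rewrite -leqn0 -(n0 i).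
rewrite (idE l ln) (idE m mn) sps_idm sp_idm pM sg_idm.
by rewrite (can_eq (@rg_idm _ G)).
Qed.

Lemma sps_sp_deg l m : (forall i, deg l i = deg m i) ->
  sps l ** sp m = if l == m then p (sg l) else 0.
Proof. by move=> lm; apply: (@sps_sp (deg m)); apply: in_Lle_deg. Qed.

Lemma p_sum v n : exists ls : seq (Mor G),
  (forall l, l \in ls -> rg l = v /\ in_Lle n l) /\
  p v = \sum_(l <- ls) sp l ** sps l.
Proof.
case: (nonzero_degP n) => [n0|n0].
  have [ls [uls lsP]] := Lle_finite rfG v n.
  exists ls; split=> [l /lsP//|].
  by case: KP => _ [_ [_ [_ [_ [_ /(_ n n0 v ls uls lsP)]]]]].
exists [:: idm v]; rewrite big_seq1 sp_idm sps_idm pM eqxx; split=> // l.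
rewrite inE => /eqP->; rewrite rg_idm; split=> //.
by apply: in_Lle_deg => i; rewrite deg_idm n0.
Qed.

(** KP4 is inserted at the common source. Taking N - d(b) for [n], where d(b) <= N, puts every
    [comp b l] in Lambda^{<=N}. *)
Lemma sp_sps_expand n a b : sg a = sg b -> exists ls : seq (Mor G),
  (forall l, l \in ls -> rg l = sg b /\ in_Lle n l) /\
  sp a ** sps b = \sum_(l <- ls) sp (comp a l) ** sps (comp b l).
Proof.
move=> ab; have [ls [lsP pE]] := p_sum (sg b) n; exists ls; split=> //.
rewrite -(sp_p a) ab pE nmul_sumr nmul_suml; apply: eq_big_seq => l /lsP[lb _].
by rewrite sp_comp ?sps_comp ?ab // !nmulA.
Qed.

(** [homog] admits pairs of paths with different sources; orthogonality of the source projections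
    shows that these contribute nothing. *)
Lemma sp_sps0 a b : sg a != sg b -> sp a ** sps b = 0.
Proof.
by move=> ab; rewrite -(sp_p a) -(p_sps b) -nmulA (nmulA (p _)) pM (negPf ab)
  nmul0l nmul0r.
Qed.

(** * Spans of products s_a s_b^* under a condition on the pair *)

Definition spanned (P : Mor G -> Mor G -> Prop) (x : A) : Prop :=
  exists l : seq (R * Mor G * Mor G),
    (forall c, c \in l -> P c.1.2 c.2) /\
    x = \sum_(c <- l) c.1.1 *: (sp c.1.2 ** sps c.2).

Section Spanned.
Variable P : Mor G -> Mor G -> Prop.

Lemma spanned0 : spanned P 0.
Proof. by exists [::]; rewrite big_nil. Qed.

Lemma spannedD x y : spanned P x -> spanned P y -> spanned P (x + y).
Proof.
move=> [l [lP ->]] [m [mP ->]]; exists (l ++ m); rewrite big_cat; split=> // c.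
by rewrite mem_cat => /orP[/lP|/mP].
Qed.

Lemma spannedZ r x : spanned P x -> spanned P (r *: x).
Proof.
move=> [l [lP ->]]; exists [seq (r * c.1.1, c.1.2, c.2) | c <- l].
split=> [c /mapP[c' /lP Pc ->]//|].
by rewrite big_map scaler_sumr; apply: eq_bigr => c _; rewrite scalerA.
Qed.

Lemma spanned_sum (T : eqType) (l : seq T) (Q : pred T) (F : T -> A) :
  (forall c, c \in l -> Q c -> spanned P (F c)) ->
  spanned P (\sum_(c <- l | Q c) F c).
Proof.
move=> PF; rewrite big_seq_cond; elim/big_ind: _ => [|x y|c /andP[]].
- exact: spanned0.
- exact: spannedD.
- exact: PF.
Qed.

Lemma spanned_sp_sps a b : P a b -> spanned P (sp a ** sps b).
Proof.
move=> Pab; exists [:: (1, a, b)]; rewrite big_seq1 scale1r; split=> // c.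
by rewrite inE => /eqP->.
Qed.

End Spanned.

(** * Degrees in Z^k and homogeneous elements *)

Definition degv (l : Mor G) : grade := [ffun i => (deg l i)%:Z].

Lemma homogE d : homog sp sps d = spanned (fun a b => degv a - degv b = d).
Proof.
rewrite -[LHS]/(spanned (fun a b =>
  forall i, (deg a i)%:Z - (deg b i)%:Z = d i)).
congr spanned; apply/funext => a; apply/funext => b; apply/propext.
split=> [abd|<- i]; last by rewrite !ffunE.
by apply/ffunP => i; rewrite !ffunE.
Qed.

Lemma homog_sp_sps a b : homog sp sps (degv a - degv b) (sp a ** sps b).
Proof. by rewrite homogE; apply: spanned_sp_sps. Qed.

Lemma degv_idm v : degv (idm v) = 0.
Proof. by apply/ffunP => i; rewrite !ffunE deg_idm. Qed.

Lemma degv_comp l m : sg l = rg m -> degv (comp l m) = degv l + degv m.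
Proof. by move=> lm; apply/ffunP => i; rewrite !ffunE deg_comp // PoszD. Qed.

Lemma homog_sp l : homog sp sps (degv l) (sp l).
Proof.
by have := homog_sp_sps l (idm (sg l)); rewrite sps_idm sp_p degv_idm subr0.
Qed.

Lemma homog_sps l : homog sp sps (- degv l) (sps l).
Proof.
by have := homog_sp_sps (idm (sg l)) l; rewrite sp_idm p_sps degv_idm sub0r.
Qed.

Lemma homog_p v : homog sp sps 0 (p v).
Proof. by have := homog_sp (idm v); rewrite sp_idm degv_idm. Qed.

(* Both factors are expanded to the common degree bound [max (d b) (d c)],
   after which KP3 applies. *)
Lemma sps_sp_homog a b c e :
  homog sp sps (degv a - degv b + (degv c - degv e))
    (sp a ** sps b ** (sp c ** sps e)).
Proof.
rewrite homogE; case: (eqVneq (sg a) (sg b)) => [ab|/sp_sps0->]; last first.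
  by rewrite nmul0l; apply: spanned0.
case: (eqVneq (sg c) (sg e)) => [ce|/sp_sps0->]; last first.
  by rewrite nmul0r; apply: spanned0.
pose n i := maxn (deg b i) (deg c i).
have [ls [lsP ->]] := sp_sps_expand (fun i => (n i - deg b i)%N) ab.
have [ms [msP ->]] := sp_sps_expand (fun i => (n i - deg c i)%N) ce.
rewrite nmul_suml; apply: spanned_sum => l /lsP[lb ln] _.
rewrite nmul_sumr; apply: spanned_sum => m /msP[me mn] _.
rewrite -nmulA (nmulA (sps _)).
have bln : in_Lle n (comp b l).
  by apply: in_Lle_comp => // i; rewrite leq_maxl.
have cmn : in_Lle n (comp c m).
  by apply: in_Lle_comp; rewrite ?ce // => i; rewrite leq_maxr.
rewrite (sps_sp bln cmn); case: eqP => [blcm|_]; last first.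
  by rewrite nmul0l nmul0r; apply: spanned0.
rewrite sg_comp // nmulA -[sg l](@sg_comp _ _ a) ?ab // sp_p.
suff <- : degv (comp a l) - degv (comp e m)
          = degv a - degv b + (degv c - degv e) by apply: spanned_sp_sps.
(* Comparing degrees in b l = c m expresses d(l) through the other degrees. *)
have /(congr1 degv) := blcm.
rewrite !degv_comp ?ab ?ce // => /(canRL (addKr _)) ->.
by rewrite opprD !addrA [LHS]addrAC addrK.
Qed.

Lemma homogM d e x y : homog sp sps d x -> homog sp sps e y ->
  homog sp sps (d + e) (x ** y).
Proof.
rewrite !homogE => -[l [lP ->]] [m [mP ->]].
rewrite nmul_suml; apply: spanned_sum => c /lP <- _.
rewrite nmul_sumr; apply: spanned_sum => c' /mP <- _.
rewrite nmulZl nmulZr; do 2!apply: spannedZ.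
rewrite -homogE; exact: sps_sp_homog.
Qed.


(* The graded model: [single d x] is [x] placed in degree [d], recorded as [x]
   itself, as a function on degrees, and as the operator that multiplies by [x]
   and shifts by [d].  The sums of such triples with [x] homogeneous of degree
   [d] form an algebra, which carries a Kumjian-Pask family. *)
Local Notation triple :=
  (A * (grade -> A) * ((grade -> A) -> grade -> A))%type.

Definition single (d : grade) (x : A) : triple :=
  (x, fun n => if n == d then x else 0, fun f n => x ** f (n - d)).

(** On sums of [single]s the middle entry is multiplied by convolution; letting [s.2] act avoids
    summing over all degrees and turns associativity into that of composition. *)
Definition tmul (s t : triple) : triple := (s.1.1 ** t.1.1, s.2 t.1.2, s.2 \o t.2).

Lemma tripleP (s t : triple) : s.1.1 = t.1.1 -> s.1.2 =1 t.1.2 ->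
  (forall f, s.2 f =1 t.2 f) -> s = t.
Proof.
case: s t => [[a g] T] [[a' g'] T'] /= -> gg' TT'.
by congr (_, _, _); apply/funext => f; [|apply/funext => n; apply: TT'].
Qed.

Lemma singleD d x y : single d (x + y) = single d x + single d y.
Proof.
apply: tripleP => //= [n|f n]; last by rewrite nmulDl.
by rewrite !fctE; case: eqP; rewrite ?addr0.
Qed.

Lemma singleZ d r x : single d (r *: x) = r *: single d x.
Proof.
apply: tripleP => //= [n|f n]; last by rewrite nmulZl.
by rewrite !fctE; case: eqP; rewrite ?scaler0.
Qed.

Lemma single0 d : single d 0 = 0.
Proof. by rewrite -(scale0r (0 : A)) singleZ scale0r. Qed.

Lemma single_sum d (T : Type) (l : seq T) (P : pred T) (F : T -> A) :
  single d (\sum_(c <- l | P c) F c) = \sum_(c <- l | P c) single d (F c).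
Proof. exact: (big_morph _ (singleD d) (single0 d)). Qed.

Lemma tmul_single d e x y :
  tmul (single d x) (single e y) = single (d + e) (x ** y).
Proof.
apply: tripleP => //= [n|f n]; last by rewrite nmulA opprD addrA.
by rewrite subr_eq [e + d]addrC; case: eqP; rewrite ?nmul0r.
Qed.

Definition homog_sum (t : triple) : Prop :=
  exists l : seq (grade * A),
    (forall c, c \in l -> homog sp sps c.1 c.2) /\
    t = \sum_(c <- l) single c.1 c.2.

Lemma homog_sum_single d x : homog sp sps d x -> homog_sum (single d x).
Proof.
move=> dx; exists [:: (d, x)]; rewrite big_seq1; split=> // c.
by rewrite inE => /eqP->.
Qed.

Lemma homog_sum0 : homog_sum 0.
Proof. by exists [::]; rewrite big_nil. Qed.

Lemma homog_sumD s t : homog_sum s -> homog_sum t -> homog_sum (s + t).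
Proof.
move=> [l [lP ->]] [m [mP ->]]; exists (l ++ m); rewrite big_cat; split=> // c.
by rewrite mem_cat => /orP[/lP|/mP].
Qed.

Lemma homog_sumZ r t : homog_sum t -> homog_sum (r *: t).
Proof.
move=> [l [lP ->]]; exists [seq (c.1, r *: c.2) | c <- l].
split=> [c /mapP[c' /lP Pc ->]|].
  by move: Pc; rewrite homogE; apply: spannedZ.
by rewrite big_map scaler_sumr; apply: eq_bigr => c _; rewrite singleZ.
Qed.

(** Each summand acts by a shifted left multiplication, which is linear. The operator of an
    arbitrary triple need not be, hence the restriction to [homog_sum] in [tmulDr] and [tmulZr]. *)
Lemma homog_sum_op t : homog_sum t ->
  (forall f g, t.2 (f + g) = t.2 f + t.2 g) /\
  (forall r f, t.2 (r *: f) = r *: t.2 f).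
Proof.
case=> l [_ ->]; elim: l => [|c l [lD lZ]].
  by rewrite big_nil; split=> *; rewrite ?addr0 ?scaler0.
rewrite big_cons; split=> [f g|r f] /=; apply/funext => n.
  by rewrite !fctE lD !fctE nmulDr addrACA.
by rewrite !fctE lZ !fctE nmulZr scalerDr.
Qed.

Lemma tmulA : associative tmul.
Proof. by move=> s t u; rewrite /tmul nmulA. Qed.

Lemma tmulDl s t u : tmul (s + t) u = tmul s u + tmul t u.
Proof. by rewrite /tmul /= nmulDl. Qed.

Lemma tmulDr s t u : homog_sum s -> tmul s (t + u) = tmul s t + tmul s u.
Proof.
case/homog_sum_op=> sD _; apply: tripleP => //= [|n|f n].
- by rewrite nmulDr.
- by rewrite sD.
- by rewrite [(t.2 + u.2) f]fctE sD.
Qed.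

Lemma tmulZl r s t : tmul (r *: s) t = r *: tmul s t.
Proof. by rewrite /tmul /= nmulZl. Qed.

Lemma tmulZr r s t : homog_sum s -> tmul s (r *: t) = r *: tmul s t.
Proof.
case/homog_sum_op=> _ sZ; apply: tripleP => //= [|n|f n].
- by rewrite nmulZr.
- by rewrite sZ.
- by rewrite [(r *: t.2) f]fctE sZ.
Qed.

Lemma homog_sumM s t : homog_sum s -> homog_sum t -> homog_sum (tmul s t).
Proof.
move=> sP [l [lP ->]]; rewrite big_seq.
elim/big_ind: _ => [|x y|[e y] /lP /= ey].
- by rewrite -(scale0r 0) tmulZr // scale0r; apply: homog_sum0.
- by rewrite tmulDr //; apply: homog_sumD.
case: sP => m [mP ->]; rewrite big_seq.
elim/big_ind: _ => [|x z|[d x] /mP /= dx].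
- by rewrite -(scale0r 0) tmulZl scale0r; apply: homog_sum0.
- by rewrite tmulDl; apply: homog_sumD.
by rewrite tmul_single; apply/homog_sum_single/homogM.
Qed.

(** * The model algebra and its Kumjian-Pask family *)

Definition gmodel_pred : {pred triple} := fun t => `[< homog_sum t >].

Fact gmodel_submod : GRing.submod_closed gmodel_pred.
Proof.
split=> [|r s t /asboolP sP /asboolP tP]; apply/asboolP; first exact: homog_sum0.
by apply: homog_sumD => //; apply: homog_sumZ.
Qed.
HB.instance Definition _ :=
  GRing.isSubmodClosed.Build R triple gmodel_pred gmodel_submod.

Record gmodel := GModel { gval : triple; _ : gval \in gmodel_pred }.
HB.instance Definition _ := [isSub for gval].
HB.instance Definition _ := [Choice of gmodel by <:].
HB.instance Definition _ := [SubChoice_isSubLmodule of gmodel by <:].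

Definition gmodel_of t (tP : homog_sum t) : gmodel := GModel (asboolT tP).

Lemma gvalP (x : gmodel) : homog_sum (gval x).
Proof. exact/asboolP/(valP x). Qed.

Definition gmul (x y : gmodel) : gmodel :=
  gmodel_of (homog_sumM (gvalP x) (gvalP y)).

Definition gmodel_nalg : nalg R.
Proof.
apply: (@NAlg R gmodel gmul) => [x y z|x y z|x y z|r x y|r x y];
  apply: val_inj => /=.
- by rewrite tmulA.
- by rewrite tmulDl.
- by rewrite tmulDr //; apply: gvalP.
- by rewrite tmulZl.
- by rewrite tmulZr //; apply: gvalP.
Defined.


Definition gp v : gmodel_nalg := gmodel_of (homog_sum_single (homog_p v)).
Definition gsp l : gmodel_nalg := gmodel_of (homog_sum_single (homog_sp l)).
Definition gsps l : gmodel_nalg := gmodel_of (homog_sum_single (homog_sps l)).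

(** Every relation is homogeneous: its two sides carry the same degree, so it reduces to the same
    relation in [A]. *)
Lemma gmodel_KP : KP_family gp gsp gsps.
Proof.
split=> [v|].
  by split; apply: val_inj; rewrite /= degv_idm ?oppr0 ?sp_idm ?sps_idm.
split=> [v|]; first by apply: val_inj; rewrite /= tmul_single pM eqxx addr0.
split=> [v w /eqP/negPf vw|].
  by apply: val_inj; rewrite /= tmul_single pM vw single0.
split=> [l m lm|].
  split; apply: val_inj => /=; rewrite tmul_single degv_comp //.
    by rewrite sp_comp.
  by rewrite opprD addrC sps_comp.
split=> [l|].
  by do !split; apply: val_inj;
    rewrite /= tmul_single ?add0r ?addr0 ?p_sp ?sp_p ?p_sps ?sps_p.
split=> [n _ l m ln mn|n n0 v ls uls lsP].
  apply: val_inj => /=; rewrite tmul_single (sps_sp ln mn).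
  by case: eqP => [->|_]; rewrite ?single0 // addNr.
apply: val_inj; rewrite raddf_sum /=.
under eq_bigr do rewrite tmul_single subrr.
rewrite -single_sum; congr single.
by case: KP => _ [_ [_ [_ [_ [_ /(_ n n0 v ls uls lsP)]]]]].
Qed.

(** * The grading drawn from the universal property *)

Hypothesis uKP : is_KP_algebra p sp sps.

(* [h x] lists the homogeneous components of [x] in its second entry. *)
Lemma graded_model : exists h : A -> triple,
  [/\ forall x y, h (x + y) = h x + h y, forall r x, h (r *: x) = r *: h x,
      forall x y, h (x ** y) = tmul (h x) (h y),
      forall x, homog_sum (h x) /\ (h x).1.1 = x &
      forall d x, homog sp sps d x -> h x = single d x].
Proof.
have [f [[[fD [fZ fM]] [fp fs]] _]] := uKP.2 _ _ _ _ gmodel_KP.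
(* Following [f] by the first entry gives an endomorphism of [A] fixing the generators, which
   uniqueness forces to be the identity. *)
have fstf x : (gval (f x)).1.1 = x.
  have [i [_ iE]] := uKP.2 A p sp sps KP.
  rewrite (iE (fun x => (gval (f x)).1.1)); first by rewrite -(iE id).
  - by split=> [y z|]; [|split=> [r y|y z]]; rewrite ?fD ?fZ ?fM.
  - by move=> v; rewrite fp.
  - by move=> l; case: (fs l) => -> ->.
pose h x := gval (f x).
have hD x y : h (x + y) = h x + h y by rewrite /h fD.
have hZ r x : h (r *: x) = r *: h x by rewrite /h fZ.
have hM x y : h (x ** y) = tmul (h x) (h y) by rewrite /h fM.
exists h; split=> // [x|d x]; first by split; [apply: gvalP | apply: fstf].
rewrite homogE => -[l [lP ->]].
have h0 : h 0 = 0 by rewrite -(scale0r (0 : A)) hZ scale0r.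
rewrite (big_morph h hD h0) single_sum; apply: eq_big_seq => c /lP <-.
rewrite hZ hM singleZ -tmul_single.
by rewrite /h; case: (fs c.1.2) (fs c.2) => -> _ [_ ->].
Qed.

(** The triple [h x] is a finite sum of [single]s by construction and has first entry [x]; merging
    summands of equal degree makes the degrees distinct. *)
Lemma homog_decomposition x : exists l : seq (grade * A),
  [/\ uniq (map fst l), forall c, c \in l -> homog sp sps c.1 c.2 &
      x = \sum_(c <- l) c.2].
Proof.
have [h [_ _ _ /(_ x)[[l [lP hx]] xE] _]] := graded_model.
pose D := undup (map fst l).
exists [seq (d, \sum_(c <- l | c.1 == d) c.2) | d <- D]; split.
- by rewrite -map_comp map_id undup_uniq.
- move=> _ /mapP[d _ ->] /=; rewrite homogE; apply: spanned_sum => c cl /eqP <-.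
  by rewrite -homogE; apply: lP.
rewrite big_map -xE hx.
rewrite (big_morph (fun t : triple => t.1.1) (id1 := 0) (op1 := +%R)) //.
exact: big_group.
Qed.

(** * Ideals generated by vertex projections *)

Lemma I_of_ideal (H : Obj G -> Prop) : ideal (I_of p H).
Proof.
split; first by move=> I [].
split=> [x y Ix Iy I idI IH|].
  by case: (idI) => _ [IB _]; apply: IB; [apply: Ix|apply: Iy].
split=> [r x Ix I idI IH|a x Ix].
  by case: (idI) => _ [_ [IZ _]]; apply: IZ; apply: Ix.
by split=> I idI IH; case: (idI) => _ [_ [_ IM]];
  case: (IM a x) => //; apply: Ix.
Qed.

Lemma I_of_p (H : Obj G -> Prop) v : H v -> I_of p H (p v).
Proof. by move=> Hv I _; apply. Qed.

Lemma I_of_mono (H K : Obj G -> Prop) : (forall v, H v -> K v) ->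
  forall x, I_of p H x -> I_of p K x.
Proof. by move=> HK x; apply; [apply: I_of_ideal | move=> v /HK/I_of_p]. Qed.

Lemma I_of_sub (J : A -> Prop) x : ideal J -> I_of p (H_of p J) x -> J x.
Proof. by move=> idJ; apply. Qed.

(* The elements whose components stay in [I_of p H], also after multiplication,
   form an ideal containing the generators. *)
Lemma I_of_graded (H : Obj G -> Prop) : graded_ideal sp sps (I_of p H).
Proof.
split=> [|x Ix l ul lP xE c cl]; first exact: I_of_ideal.
have [h [hD hZ hM hP hE]] := graded_model.
have [I0 [IB [IZ IM]]] := I_of_ideal H; set I := I_of p H in Ix I0 IB IZ IM *.
(* The operator of [t] is a finite sum of shifted left multiplications, so it preserves [I]-valued
   functions. *)
have opI t f : homog_sum t -> (forall n, I (f n)) -> forall n, I (t.2 f n).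
  move=> [m [mP ->]] If n; elim: m {mP} => [|e m IHm]; first by rewrite big_nil.
  rewrite big_cons; apply: (idealD (I_of_ideal H)) => //=.
  by case: (IM e.2 (f (n - e.1))).
(* The second clause handles right multiplication: the components of y a are the operator of [h y]
   applied to those of a. *)
pose K y := (forall n, I ((h y).1.2 n)) /\ forall f n, I ((h y).2 f n).
have hN y z : h (y - z) = h y - h z by rewrite -scaleN1r hD hZ scaleN1r.
have idK : ideal K.
  split; first by rewrite -(scale0r (0 : A)) /K hZ scale0r.
  split=> [y z [Ky Ky'] [Kz Kz']|].
    by rewrite /K hN; split=> [n|f n]; apply: IB.
  split=> [r y [Ky Ky']|a y [Ky Ky']].
    by rewrite /K hZ; split=> [n|f n]; apply: IZ.
  rewrite /K !hM; split; split=> [n|f n] //=.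
  - by apply: opI => //; case: (hP a).
  - by apply: opI => //; case: (hP a).
have Kp v : H v -> K (p v).
  move=> Hv; rewrite /K (hE _ _ (homog_p v)).
  split=> [n|f n] /=; first by case: eqP => // _; apply: I_of_p.
  by case: (IM (f (n - 0)) _ (I_of_p Hv)).
have [/(_ c.1) + _] := Ix K idK Kp.
have h0 : h 0 = 0 by rewrite -(scale0r (0 : A)) hZ scale0r.
(* The degrees in [l] are distinct, so only [c] contributes to the entry of [h x] in degree
   [c.1]. *)
rewrite xE (big_morph h hD h0).
rewrite (big_morph (fun t : triple => t.1.2 c.1) (id1 := 0) (op1 := +%R)) //.
rewrite (bigD1_seq c) ?(map_uniq ul) //= (hE _ _ (lP _ cl)) /= eqxx.
rewrite big_seq_cond big1 ?addr0 // => e /andP[el ec].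
rewrite (hE _ _ (lP _ el)) /=; case: eqP => // ce.
by rewrite (uniq_map_inj ul el cl) ?eqxx in ec.
Qed.

(* The coefficients of [x] are recovered up to vertex projections: multiply by
   [sps a] on the left and [sp b] on the right, for [b] in [Lle n]. *)
Lemma homog_basic (I : A -> Prop) d x : basic_ideal p I -> homog sp sps d x ->
  I x -> I_of p (H_of p I) x.
Proof.
move=> [idI basI]; rewrite homogE => -[l0 [l0P xE]] Ix.
(* This bounds every d(b) in the given sum, so that each b can be extended into Lambda^{<=n}. *)
pose n i := \max_(c <- l0) deg c.2 i.
pose P a b := [/\ degv a - degv b = d, in_Lle n b & sg a = sg b].
have [l [lP {}xE]] : spanned P x.
  rewrite xE; apply: spanned_sum => c cl _; apply: spannedZ.
  case: (eqVneq (sg c.1.2) (sg c.2)) => [ab|/sp_sps0->]; last exact: spanned0.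
  have [ls [lsP ->]] := sp_sps_expand (fun i => (n i - deg c.2 i)%N) ab.
  apply: spanned_sum => m /lsP[mb mn] _; apply: spanned_sp_sps; split.
  - rewrite !degv_comp ?ab // -(l0P c cl).
    by rewrite opprD addrACA subrr addr0.
  - apply: in_Lle_comp => // i.
    by rewrite /n; exact: (@leq_bigmax_seq _ l0 xpredT (fun c => deg c.2 i)).
  - by rewrite !sg_comp ?ab.
pose key (c : R * Mor G * Mor G) := (c.1.2, c.2).
rewrite xE (big_group key); apply: ideal_sum => [|ab]; first exact: I_of_ideal.
rewrite mem_undup => /mapP[c0 c0l ->] _.
have [c0d c0n c0s] := lP c0 c0l.
(* The sum may list one pair of paths several times, so the coefficients of that pair are added
   up. *)
pose r := \sum_(c <- l | key c == key c0) c.1.1.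
have Ir : I (r *: p (sg c0.1.2)).
  have [_ [_ [_ IM]]] := idI.
  have := (IM (sp c0.2) _ (IM (sps c0.1.2) x Ix).1).2.
  rewrite xE nmul_sumr nmul_suml.
  congr I; rewrite scaler_suml [RHS]big_mkcond; apply: eq_big_seq => c cl.
  have [cd cn cs] := lP c cl.
  rewrite nmulZr nmulZl nmulA -nmulA (sps_sp cn c0n) /key xpair_eqE.
  case: (eqVneq c.2 c0.2) => [cc0|_]; last by rewrite andbF nmul0r scaler0.
  (* Both pairs have degree [d] and the same second path, so their first paths have equal degree and
     KP3 applies to these. *)
  rewrite sps_sp_deg => [|i].
    rewrite andbT eq_sym; case: eqP => _; last by rewrite nmul0l scaler0.
    by rewrite cc0 -c0s pM eqxx.
  move: cd; rewrite cc0 -c0d => /addIr /ffunP/(_ i).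
  by rewrite !ffunE => -[].
under eq_bigr => c /eqP[-> ->] do [].
rewrite -scaler_suml -/r.
have [_ [_ [IZ IM]]] := I_of_ideal (H_of p I).
case: (eqVneq r 0) => [->|r0].
  by rewrite scale0r; case: (I_of_ideal (H_of p I)).
apply: IZ; rewrite -(sp_p c0.1.2).
apply: (proj2 (IM _ _ _)); apply: (proj1 (IM _ _ _)).
by apply: I_of_p; apply: basI Ir.
Qed.

Lemma graded_basic_le (I : A -> Prop) : basic_ideal p I ->
  graded_ideal sp sps I -> forall x, I x -> I_of p (H_of p I) x.
Proof.
move=> basI [idI gI] x Ix.
have [l [ul lP xE]] := homog_decomposition x.
rewrite xE; apply: ideal_sum => [|c cl _]; first exact: I_of_ideal.
by apply: (homog_basic basI (lP c cl)); apply: (gI x Ix l).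
Qed.

End KumjianPask.

(** * The largest basic graded ideal inside [J] *)

Theorem mainTheorem2 (k : nat) (G : kgraph k) (R : comPzRingType) (A : nalg R)
  (p : Obj G -> A) (sp sps : Mor G -> A) :
  row_finite G -> locally_convex G -> is_KP_algebra p sp sps ->
  forall J : A -> Prop, basic_ideal p J ->
  let I := I_of p (H_of p J) in
  [/\ basic_ideal p I, graded_ideal sp sps I, (forall x, I x -> J x) &
      forall I' : A -> Prop, basic_ideal p I' -> graded_ideal sp sps I' ->
        (forall x, I' x -> J x) -> forall x, I' x -> I x].
Proof.
move=> rfG _ uKP J [idJ basJ] I; have KP := uKP.1.
have IJ x : I x -> J x by apply: I_of_sub.
split=> //.
- split=> [|v r r0 Irp]; first exact: I_of_ideal.
  (* The nonzero multiple of p_v lies in [J], and basicness of [J] puts [v] in H(J). *)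
  by apply: I_of_p; apply: basJ r0 _; apply: IJ.
- exact: I_of_graded.
- move=> I' basI' gI' I'J x I'x.
  (* Since I' lies in [J], H(I') lies in H(J); it remains to place I' inside I(H(I')). *)
  apply: (@I_of_mono _ _ _ _ p (H_of p I')) => [v|]; first exact: I'J.
  exact: (graded_basic_le rfG KP uKP).
Qed.
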